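(* Let $G=(\mathcal{V},\mathcal{E})$ be a finite undirected connected simple graph with at least two vertices, let $w$ be an edge-weight function on $G$ with asymmetry $\tau_w$, and let $f:\mathcal{E}\to\mathbb{R}$ be a nonnegative edge-cost function. Then for any $x,y\in\mathcal{V}$, $$\mathcal{H}^f_w(x,y)\leqslant\sum_{e\in\mathcal{E}}\Bigl(1+2\sum_{i=1}^{\mathrm{d}_y(e)}\tau_w^i\Bigr)\cdot f(e),$$ where $\mathrm{d}_y(e)$ is the minimum of the graph distances between $y$ and the two endpoints of $e$.
   Context: An edge-weight function is a map $w:\mathcal{V}\times\mathcal{V}\to\mathbb{R}$ with $w(x,y)=w(y,x)>0$ if $x,y$ are adjacent and $w(x,y)=0$ otherwise; it defines the random walk with transition probabilities $p_{xy}=w(x,y)/\sum_{z\in\mathcal{V}}w(x,z)$. With $\mathcal{N}(x)$ the set of neighbors of $x$, the asymmetry is $\tau_w=\max_{x\in\mathcal{V}}\max_{y,z\in\mathcal{N}(x)}w(x,y)/w(x,z)$. The cost of a finite walk is the sum of $f(e)$ over its traversed edges, counted with multiplicity. $\mathcal{H}^f_w(x,y)$ is the expected cost of the random walk started at $x$ and stopped upon first reaching $y$. *)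

(* Defs.v *)
From HB Require Import structures.
From mathcomp Require Import all_boot all_order all_algebra.
From mathcomp Require Import all_classical all_reals all_analysis.

Set Implicit Arguments.
Unset Strict Implicit.
Unset Printing Implicit Defensive.

Import Order.TTheory GRing.Theory Num.Theory.

Local Open Scope classical_set_scope.
Local Open Scope ring_scope.

(* The least element of P, with value 0 if P is empty. *)
Definition least (P : pred nat) : nat :=
  if pselect (exists n, P n) is left exP then ex_minn exP else 0%N.

Definition simple_graph (V : finType) (e : rel V) : Prop :=
  symmetric e /\ irreflexive e.

Definition connected_graph (V : finType) (e : rel V) : Prop :=
  forall x y : V, connect e x y.

Definition edge_set (V : finType) (e : rel V) : {set {set V}} :=
  [set E : {set V} | [exists x, exists y, e x y && (E == [set x; y]%SET)]]%SET.

Definition edge (V : finType) (e : rel V) : finType :=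
  {E : {set V} | E \in edge_set e}.

Definition gdist (V : finType) (e : rel V) (x y : V) : nat :=
  least (fun n => [exists p : n.-tuple V, path e x p && (last x p == y)]).

Definition edge_dist (V : finType) (e : rel V) (y : V) (E : edge e) : nat :=
  least (fun n => [exists z in val E, gdist e y z == n]).

Definition edge_weight (R : realType) (V : finType) (e : rel V)
    (w : V -> V -> R) : Prop :=
  [/\ forall x y, w x y = w y x,
      forall x y, e x y -> 0 < w x y
    & forall x y, ~~ e x y -> w x y = 0].

(* All ratios are positive, so the default value 0 does not affect the maxima. *)
Definition asymmetry (R : realType) (V : finType) (e : rel V)
    (w : V -> V -> R) : R :=
  \big[Num.max/0]_(x : V)
    \big[Num.max/0]_(y | e x y) \big[Num.max/0]_(z | e x z) (w x y / w x z).

Definition transition (R : realType) (V : finType) (w : V -> V -> R)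
    (x y : V) : R :=
  w x y / \sum_(z : V) w x z.

(* X is a Markov chain on V with transition probabilities p, started at x.
   The Markov property is in product form, so that it needs no conditioning on
   null events. *)
Record markov_chain (R : realType) (V : finType) (p : V -> V -> R) (x : V)
    (d : measure_display) (T : measurableType d) (P : probability T R)
    (X : nat -> T -> V) : Prop := MarkovChain {
  chain_measurable : forall n v, measurable [set t | X n t = v];
  chain_start : P [set t | X 0%N t = x] = 1%E;
  chain_step : forall (n : nat) (s : nat -> V),
    P [set t | forall k, (k <= n.+1)%N -> X k t = s k] =
    (P [set t | forall k, (k <= n)%N -> X k t = s k]
       * (p (s n) (s n.+1))%:E)%E
}.

(* The value 0 off the edges is used only on a null event. *)
Definition step_cost (R : realType) (V : finType) (e : rel V)
    (f : edge e -> R) (x y : V) : R :=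
  if insub [set x; y]%SET is Some E then f E else 0.

(* The n-th step, from u n to u n.+1, is traversed iff u 0, ..., u n all differ
   from y; in particular the cost is 0 if u 0 = y. *)
Definition cost_until (R : realType) (V : finType) (e : rel V)
    (f : edge e -> R) (y : V) (u : nat -> V) : \bar R :=
  (\sum_(0 <= n <oo)
     (if [forall k : 'I_n.+1, u k != y] then step_cost f (u n) (u n.+1)
      else 0)%:E)%E.

Definition expected_cost (R : realType) (V : finType) (e : rel V)
    (f : edge e -> R) (y : V)
    (d : measure_display) (T : measurableType d) (P : probability T R)
    (X : nat -> T -> V) : \bar R :=
  (\int[P]_t cost_until f y (fun n => X n t))%E.

(* Main.v *)
Require Import Defs.
From HB Require Import structures.
From mathcomp Require Import all_boot all_order all_algebra.
From mathcomp Require Import all_classical all_reals all_analysis.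
From mathcomp Require Import measurable_realfun.

Import Order.TTheory GRing.Theory Num.Theory.

Local Open Scope ring_scope.

(** Let [q n u] be the probability that the walk is at [u] at time [n] without
    having met [y], and let [g u] be the sum of [q n u / W u] over [n < N],
    where [W u] is the total weight at [u].  The expected number of traversals
    of an edge [uv] up to time [N] is [w u v * (g u + g v)].  Reversibility
    makes [g] the potential of a flow with total source at most [1] whose sinks
    are [y] and the mass [q N] still alive, so every edge carries at most one
    unit: [w u v * |g u - g v| <= 1].  Summing potential drops along a shortest
    path from [u] to [y], where [g y = 0], and paying a factor [tau] each time
    the weight of an edge is compared with that of the next one, gives
    [w u v * g u <= tau + ... + tau ^ d(u, y)].  The bound is uniform in [N],
    so monotone convergence concludes. *)

(** * Distances and edges of the graph *)

Lemma leastP (A : pred nat) : (exists n, A n) -> A (least A).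
Proof.
by rewrite /least; case: pselect => // exA _; case: ex_minnP.
Qed.

Section Graph.
Variables (V : finType) (e : rel V).

Lemma gdist_path (x y : V) : connect e x y ->
  exists p, [/\ path e x p, last x p = y & size p = gdist e x y].
Proof.
move=> /connectP[p ep ->]; set z := last x p.
have /leastP/existsP[q /andP[eq_ /eqP lq]] : exists n,
    [exists p : n.-tuple V, path e x p && (last x p == z)].
  by exists (size p); apply/existsP; exists (in_tuple p); rewrite ep eqxx.
by exists q; split=> //; rewrite size_tuple.
Qed.

Lemma edge_dist_gdist (y : V) (E : edge e) :
  exists2 z, z \in val E & gdist e y z = edge_dist y E.
Proof.
have /leastP/existsP[z /andP[zE /eqP zn]] : exists n,
    [exists z in val E, gdist e y z == n]; last by exists z.
have := valP E; rewrite inE => /existsP[a /existsP[b /andP[_ /eqP Eab]]].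
exists (gdist e y a); apply/existsP; exists a.
by rewrite Eab !inE !eqxx.
Qed.

Lemma edge_endpoints (E : edge e) (z : V) : simple_graph e -> z \in val E ->
  exists2 z', e z z' & val E = [set z; z']%SET.
Proof.
move=> [sym _]; have := valP E.
rewrite inE => /existsP[a /existsP[b /andP[eab /eqP ->]]].
rewrite !inE => /orP[/eqP->|/eqP->]; first by exists b.
by exists a; rewrite ?[[set b; a]%SET]finset.setUC // sym.
Qed.

End Graph.

(** * Flows driven by a potential on the weighted graph *)

Section Flow.
Variables (R : realType) (V : finType) (e : rel V) (w : V -> V -> R).

Lemma asymmetry_ge (x y z : V) : e x y -> e x z ->
  w x y / w x z <= asymmetry e w.
Proof.
move=> exy exz; rewrite /asymmetry.
apply: le_trans (le_bigmax _ _ x).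
apply: le_trans (le_bigmax_cond _ _ exy).
exact: le_trans (le_bigmax_cond _ _ exz).
Qed.

Hypothesis w_weight : edge_weight e w.

Lemma weight_ge0 (x y : V) : 0 <= w x y.
Proof.
have [_ wpos w0] := w_weight.
by have [/wpos/ltW|/w0->] := boolP (e x y).
Qed.

(** Abstract form of the truncated Green function: [s] stands for the initial law of the killed
    walk. [div_g] is an inequality because a vertex may also absorb flow, namely the mass still
    alive at time [N]. *)
Variables (y : V) (g s : V -> R).
Hypotheses (g_ge0 : forall v, 0 <= g v) (gy : g y = 0).
Hypotheses (s_ge0 : forall v, 0 <= s v) (s_le1 : \sum_v s v <= 1).
Hypothesis div_g : forall v, v != y -> \sum_u w v u * (g v - g u) <= s v.

(* All the flow across the boundary of the superlevel set [S] of [g] at height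
   [g u] goes outwards, so the flow through [uv] is at most the divergence of
   [S], which excludes the sink [y]. *)
Lemma potential_flow_le1 (u v : V) : w u v * (g u - g v) <= 1.
Proof.
have [wsym _ _] := w_weight.
have [guv|gvu] := leP (g u) (g v).
  by rewrite (le_trans _ ler01)// mulr_ge0_le0 ?weight_ge0// subr_le0.
pose S := [pred z | g u <= g z].
pose F a b := w a b * (g a - g b).
have yS z : S z -> z != y.
  rewrite inE; apply: contraTneq => ->; rewrite gy -ltNge.
  exact: le_lt_trans gvu.
have F_anti : \sum_(a | S a) \sum_(b | S b) F a b = 0.
  have anti a b : F a b = - F b a by rewrite /F wsym -mulrN opprB.
  have : \sum_(a | S a) \sum_(b | S b) F a b =
         - \sum_(a | S a) \sum_(b | S b) F a b.
    rewrite {1}exchange_big /= -sumrN; apply: eq_bigr => a _.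
    by rewrite -sumrN; apply: eq_bigr => b _; rewrite -anti.
  by move=> /eqP; rewrite -subr_eq0 opprK -mulr2n mulrn_eq0 /= => /eqP.
have F_out a b : S a -> ~~ S b -> 0 <= F a b.
  rewrite !inE -ltNge => ua bu; rewrite mulr_ge0 ?weight_ge0// subr_ge0.
  by rewrite (le_trans (ltW bu)).
apply: le_trans s_le1.
apply: (@le_trans _ _ (\sum_(a | S a) \sum_b F a b)); last first.
  apply: (@le_trans _ _ (\sum_(a | S a) s a)).
    by apply: ler_sum => a /yS; exact: div_g.
  by rewrite [leRHS](bigID S)/= lerDl sumr_ge0.
have -> : \sum_(a | S a) \sum_b F a b = \sum_(a | S a) \sum_(b | ~~ S b) F a b.
  rewrite -[RHS]add0r -[X in X + _]F_anti -big_split /=.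
  by apply: eq_bigr => a _; rewrite (bigID S).
rewrite (bigD1 u) ?inE//= (bigD1 v) ?inE -?ltNge//= -addrA lerDl addr_ge0//.
  by apply: sumr_ge0 => b /andP[bS _]; apply: F_out => /=.
by apply: sumr_ge0 => a /andP[aS _]; apply: sumr_ge0 => b; exact: F_out.
Qed.

(** Induction on the far end of the path; [v] is kept arbitrary so that the induction hypothesis
    applies to the last edge of the path itself. *)
Lemma potential_path_le (p : seq V) (v : V) :
  simple_graph e -> path e y p -> e (last y p) v ->
  w (last y p) v * g (last y p) <=
    \sum_(1 <= i < (size p).+1) asymmetry e w ^+ i.
Proof.
move=> [esym _].
have [_ wpos _] := w_weight.
elim/last_ind: p v => [|p a IH] v /=; first by rewrite gy mulr0 big_nil.
rewrite rcons_path last_rcons size_rcons => /andP[ep eba] eav.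
set b := last y p in IH eba *.
have {}IH := IH _ ep eba; have eab : e a b by rewrite esym.
have wab := wpos _ _ eab.
(* Horner form: the [1] pays for the flow through the edge [a b], the factor for replacing that edge
   by [a v]. *)
have -> : \sum_(1 <= i < (size p).+2) asymmetry e w ^+ i =
  asymmetry e w * (1 + \sum_(1 <= i < (size p).+1) asymmetry e w ^+ i).
  rewrite big_add1 /= big_nat_recl// expr1 mulrDr mulr1; congr (_ + _).
  by rewrite big_add1 /= mulr_sumr; apply: eq_bigr => i _; rewrite exprS.
have -> : w a v * g a = w a v / w a b * (w a b * g a).
  by rewrite mulrA divfK// gt_eqF.
apply: ler_pM.
- by rewrite divr_ge0// weight_ge0.
- by rewrite mulr_ge0// weight_ge0.
- exact: asymmetry_ge.
- have := potential_flow_le1 a b; rewrite mulrBr lerBlDr => /le_trans; apply.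
  by have [wsym _ _] := w_weight; rewrite lerD2l wsym.
Qed.

Lemma edge_flow_le (E : edge e) : simple_graph e -> connected_graph e ->
  \sum_(q : V * V | [set q.1; q.2]%SET == val E) w q.1 q.2 * g q.1 <=
  1 + 2 * \sum_(1 <= i < (edge_dist y E).+1) asymmetry e w ^+ i.
Proof.
move=> e_simple e_conn; have [wsym _ _] := w_weight.
have [a aE <-] := edge_dist_gdist V e y E.
have [b eab Eab] := edge_endpoints V e E a e_simple aE.
have aNb : a != b.
  by apply: contraTneq eab => ->; rewrite e_simple.2.
have [p [ep lp <-]] := gdist_path V e y a (e_conn y a).
(* Only the two orientations of [E] contribute, and they differ because there are no loops. *)
have -> : \sum_(q : V * V | [set q.1; q.2]%SET == val E) w q.1 q.2 * g q.1 =
          w a b * g a + w b a * g b.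
  rewrite (bigD1 (a, b)) /= ?Eab ?eqxx//.
  rewrite (bigD1 (b, a)) /=; last first.
    by rewrite finset.setUC eqxx xpair_eqE eq_sym negb_and aNb.
  rewrite big1 ?addr0// => -[c d] /= /andP[/andP[/eqP/setP cd]].
  rewrite !xpair_eqE.
  have := cd a; have := cd b; have := cd c; have := cd d.
  rewrite !inE !eqxx !orbT /=.
  rewrite ![a == _]eq_sym ![b == _]eq_sym.
  move=> /esym/orP[]/eqP-> /esym/orP[]/eqP->;
  by rewrite ?eqxx ?(negPf aNb) // eq_sym ?(negPf aNb).
have flow : w a b * (g b - g a) <= 1 by rewrite wsym potential_flow_le1.
have := potential_path_le p b e_simple ep; rewrite lp => /(_ eab) pot.
rewrite [w b a]wsym -mulrDr.
(* The path bound is applied only to the nearer endpoint [a], twice; the flow bound on [E] itself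
   accounts for [g b - g a]. This is the origin of [1 + 2 * ...]. *)
have -> : g a + g b = (g b - g a) + 2 * g a.
  by rewrite mulr_natl mulr2n addrA subrK addrC.
by rewrite mulrDr lerD// mulrCA ler_wpM2l.
Qed.

End Flow.

(** * Random variables with finitely many values *)

Lemma eq_boolset (T : Type) (b b' : pred T) : b =1 b' ->
  [set t | b t]%classic = [set t | b' t]%classic.
Proof. by move=> bb'; apply/seteqP; split => t /=; rewrite bb'. Qed.

Section FiniteFibers.
Variables (d : measure_display) (T : measurableType d) (R : realType).
Variables (P : probability T R) (I : finType) (F : T -> I).
Hypothesis mF : forall i, measurable [set t | F t = i]%classic.

Lemma measurable_fin_preimage (Q : pred I) :
  measurable [set t | Q (F t)]%classic.
Proof.
suff -> : [set t | Q (F t)]%classic =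
    (\bigcup_(i in [set i | Q i]) [set t | F t = i])%classic.
  by apply: fin_bigcup_measurable => //; exact: finite_finset.
apply/seteqP; split => [t Qt|t [i Qi /= Ft]] /=; first by exists (F t).
by rewrite Ft.
Qed.

Lemma probability_fin_preimage (Q : pred I) :
  P [set t | Q (F t)]%classic = (\sum_(i | Q i) P [set t | F t = i]%classic)%E.
Proof.
(* Finite additivity by induction on a list; [uniq] makes the new fiber disjoint from the others. *)
suff H (s : seq I) : uniq s ->
    P [set t | F t \in s]%classic =
    (\sum_(i <- s) P [set t | F t = i]%classic)%E.
  rewrite -big_enum -H ?enum_uniq//; congr (P _).
  by apply/seteqP; split => t /=; rewrite mem_enum.
elim: s => [_|i s IH /andP[is_ us]].
  by rewrite big_nil -[RHS](measure0 P); congr (P _); apply/seteqP; split.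
rewrite big_cons -IH// -measureU//.
- congr (P _); apply/seteqP; split => t /=; rewrite inE.
    by move=> /orP[/eqP|]; [left|right].
  by move=> [->|->]; rewrite ?eqxx ?orbT.
- exact: measurable_fin_preimage.
- apply/seteqP; split => t //= -[Ft]; rewrite Ft => is_'.
  by rewrite is_' in is_.
Qed.

(** Serves as the law of total probability, with [G] reading off one position of the walk. *)
Lemma probability_fin_partition (J : finType) (Q : pred I) (G : I -> J) :
  P [set t | Q (F t)]%classic =
  (\sum_j P [set t | Q (F t) && (G (F t) == j)]%classic)%E.
Proof.
rewrite probability_fin_preimage (partition_big G predT)//=.
apply: eq_bigr => j _.
by rewrite -(probability_fin_preimage [pred i | Q i && (G i == j)]).
Qed.

End FiniteFibers.

(** * The Markov property for events of the past *)

Section Chain.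
Variables (R : realType) (V : finType) (p : V -> V -> R) (x : V).
Variables (d : measure_display) (T : measurableType d) (P : probability T R).
Variable X : nat -> T -> V.
Hypothesis X_chain : markov_chain p x P X.

(** As a finite function the past lies in a [finType], so every event about it is a finite union of
    fibers. *)
Definition history (n : nat) (t : T) : {ffun 'I_n.+1 -> V} :=
  [ffun k : 'I_n.+1 => X k t].

Lemma measurable_history (n : nat) (h : {ffun 'I_n.+1 -> V}) :
  measurable [set t | history n t = h]%classic.
Proof.
have -> : [set t | history n t = h]%classic =
    (\bigcap_(k in [set: 'I_n.+1]) [set t | X k t = h k])%classic.
  apply/seteqP; split => [t /= <- k _|t /= H]; first by rewrite ffunE.
  by apply/ffunP => k; rewrite ffunE; exact: H.
apply: fin_bigcap_measurable => [|k _]; first exact: finite_finset.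
exact: chain_measurable X_chain _ _.
Qed.

Let next_history n t := (history n t, X n.+1 t).

Lemma measurable_next_history (n : nat) (hv : {ffun 'I_n.+1 -> V} * V) :
  measurable [set t | next_history n t = hv]%classic.
Proof.
have -> : [set t | next_history n t = hv]%classic =
    ([set t | history n t = hv.1] `&` [set t | X n.+1 t = hv.2])%classic.
  by case: hv => h v; apply/seteqP; split => t /= => [[-> ->]|[<- <-]].
apply: measurableI; first exact: measurable_history.
exact: chain_measurable X_chain _ _.
Qed.

Lemma next_history_probability (n : nat) (h : {ffun 'I_n.+1 -> V}) (v : V) :
  P [set t | next_history n t = (h, v)]%classic =
  (P [set t | history n t = h]%classic * (p (h ord_max) v)%:E)%E.
Proof.
(* [chain_step] takes an infinite trajectory: [h] is continued by the constant [v], and only times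
   up to [n.+1] are read. *)
pose s k := if (k <= n)%N then h (inord k) else v.
have hE (t : T) : history n t = h <-> forall k, (k <= n)%N -> X k t = s k.
  split=> [Hh k kn|H]; first by rewrite /s kn -Hh ffunE inordK.
  by apply/ffunP => k; rewrite ffunE H -1?ltnS// /s -ltnS ltn_ord inord_val.
have := chain_step X_chain n s.
have -> : s n = h ord_max.
  by rewrite /s leqnn; congr (h _); apply/val_inj; rewrite /= inordK.
have -> : s n.+1 = v by rewrite /s ltnn.
have -> : [set t | forall k, (k <= n)%N -> X k t = s k]%classic =
          [set t | history n t = h]%classic.
  by apply/seteqP; split => t /= /hE.
move=> <-; congr (P _); apply/seteqP; split => t /=.
  move=> [/hE H Xv] k; rewrite leq_eqVlt => /orP[/eqP->|]; last exact: H.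
  by rewrite Xv /s ltnn.
move=> H; congr (_, _); last by rewrite H// /s ltnn.
by apply/hE => k kn; rewrite H// leqW.
Qed.

(** Summing over the histories in [Q] that end at [u], all of which share the factor [p u v]. *)
Lemma markov_property (n : nat) (Q : pred {ffun 'I_n.+1 -> V}) (u v : V) :
  P [set t | [&& Q (history n t), X n t == u & X n.+1 t == v]]%classic =
  (P [set t | Q (history n t) && (X n t == u)]%classic * (p u v)%:E)%E.
Proof.
have E1 (t : T) : [&& Q (history n t), X n t == u & X n.+1 t == v] =
    [pred hv : {ffun 'I_n.+1 -> V} * V |
      (Q hv.1 && (hv.1 ord_max == u)) && (hv.2 == v)] (next_history n t).
  by rewrite /= ffunE andbA.
have E2 (t : T) : Q (history n t) && (X n t == u) =
    [pred h : {ffun 'I_n.+1 -> V} | Q h && (h ord_max == u)] (history n t).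
  by rewrite /= ffunE.
under eq_set do rewrite E1; under [in RHS]eq_set do rewrite E2.
rewrite (probability_fin_preimage _ _ _ _ _ _ (measurable_next_history n)).
rewrite (probability_fin_preimage _ _ _ _ _ _ (measurable_history n)).
transitivity (\sum_(h : {ffun 'I_n.+1 -> V} | Q h && (h ord_max == u))
    \sum_(v' | v' == v) P [set t | next_history n t = (h, v')]%classic)%E.
  by rewrite pair_big; apply: eq_bigr => -[].
rewrite ge0_sume_distrl; last by move=> *; exact: measure_ge0.
apply: eq_bigr => h /andP[_ /eqP <-].
by rewrite big_pred1_eq next_history_probability.
Qed.


(** * The walk killed at [y] and its expected step costs *)

Variable y : V.

Let alive n t := [forall k : 'I_n.+1, X k t != y].

(** [alive n] is exactly the condition under which [cost_until] charges step [n]; it includes time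
    [n], so no mass sits at [y]. *)
Definition killed_prob (n : nat) (u : V) : R :=
  fine (P [set t | alive n t && (X n t == u)]%classic).

Lemma alive_history n t : alive n t =
  [pred h : {ffun 'I_n.+1 -> V} | [forall k, h k != y]] (history n t).
Proof. by apply: eq_forallb => k; rewrite ffunE. Qed.

Lemma measurable_alive_step (n : nat) (u v : V) :
  measurable [set t | [&& alive n t, X n t == u & X n.+1 t == v]]%classic.
Proof.
rewrite (eq_boolset _ _ (fun t => [pred hv : {ffun 'I_n.+1 -> V} * V |
    [&& [forall k, hv.1 k != y], hv.1 ord_max == u & hv.2 == v]]
    (next_history n t))); last by move=> t; rewrite alive_history /= ffunE.
exact: measurable_fin_preimage (measurable_next_history n) _.
Qed.

Lemma killed_probE (n : nat) (u : V) :
  (killed_prob n u)%:E = P [set t | alive n t && (X n t == u)]%classic.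
Proof.
rewrite fineK// fin_num_measure//.
rewrite (eq_boolset _ _ (fun t => [pred h : {ffun 'I_n.+1 -> V} |
    [forall k, h k != y] && (h ord_max == u)] (history n t))); last first.
  by move=> t; rewrite alive_history /= ffunE.
exact: measurable_fin_preimage (measurable_history n) _.
Qed.

Lemma killed_prob_ge0 (n : nat) (u : V) : 0 <= killed_prob n u.
Proof. by rewrite fine_ge0// measure_ge0. Qed.

Lemma killed_prob_target (n : nat) : killed_prob n y = 0.
Proof.
rewrite /killed_prob (_ : mkset _ = set0) ?measure0//.
apply/seteqP; split => t //= /andP[/forallP/(_ ord_max)/=].
by move=> /negPf->.
Qed.

Lemma killed_prob_step (n : nat) (u v : V) :
  P [set t | [&& alive n t, X n t == u & X n.+1 t == v]]%classic =
  (killed_prob n u * p u v)%:E.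
Proof.
rewrite EFinM killed_probE.
under eq_set do rewrite alive_history.
under [in RHS]eq_set do rewrite alive_history.
exact: markov_property.
Qed.

(** Forward equation: arriving at [v != y] cannot kill the walk, so survival up to [n] suffices;
    then split by the position at time [n]. *)
Lemma killed_probS (n : nat) (v : V) : v != y ->
  killed_prob n.+1 v = \sum_u killed_prob n u * p u v.
Proof.
move=> vy; apply: EFin_inj; rewrite killed_probE -sumEFin.
under [RHS]eq_bigr do rewrite -killed_prob_step.
pose Q := [pred hv : {ffun 'I_n.+1 -> V} * V |
  [forall k, hv.1 k != y] && (hv.2 == v)].
have -> : [set t | alive n.+1 t && (X n.+1 t == v)]%classic =
    [set t | Q (next_history n t)]%classic.
  apply: eq_boolset => t /=; rewrite -[[forall k, _]]alive_history.
  have [Xv|] := eqVneq (X n.+1 t) v; rewrite ?andbF// !andbT.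
  apply/forallP/forallP => [H k|H k]; first exact: (H (widen_ord (leqnSn _) k)).
  have := ltn_ord k; rewrite ltnS leq_eqVlt => /orP[/eqP->|kn].
    by rewrite Xv.
  exact: (H (Ordinal kn)).
rewrite (probability_fin_partition _ _ _ _ _ _ (measurable_next_history n) _ _
  (fun hv => hv.1 ord_max)).
apply: eq_bigr => u _; congr (P _); apply: eq_boolset => t.
by rewrite /= -[[forall k, _]]alive_history ffunE -andbA [(_ == v) && _]andbC.
Qed.

(** The events are disjoint; the sum vanishes when the walk starts at [y]. *)
Lemma sum_killed_prob0_le1 : \sum_v killed_prob 0 v <= 1.
Proof.
rewrite -lee_fin -sumEFin.
under eq_bigr => v _.
  rewrite killed_probE.
  rewrite (eq_boolset _ _ (fun t => [pred h : {ffun 'I_1 -> V} |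
      [forall k, h k != y]] (history 0 t) && (history 0 t ord_max == v)));
    last by move=> t; rewrite alive_history /= !ffunE.
  over.
rewrite -(probability_fin_partition _ _ _ _ _ _ (measurable_history 0) _ _
  (fun h => h ord_max)).
apply: probability_le1.
exact: measurable_fin_preimage (measurable_history 0) _.
Qed.

Variable c : V -> V -> R.
Hypothesis c_ge0 : forall u v, 0 <= c u v.

(** A finite combination of indicators yields both the measurability and the integral of the
    cost. *)
Lemma alive_cost_sum (n : nat) (t : T) :
  (if alive n t then c (X n t) (X n.+1 t) else 0)%:E =
  (\sum_(q : V * V) (c q.1 q.2 *
    \1_[set t | [&& alive n t, X n t == q.1 & X n.+1 t == q.2]]%classic t)%:E)%E.
Proof.
have indic_pred (b : T -> bool) : \1_[set t | b t]%classic t = (b t)%:R :> R.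
  rewrite indicE; case bt: (b t); first by rewrite mem_set.
  by rewrite memNset//= bt.
rewrite sumEFin; congr EFin.
under eq_bigr do rewrite indic_pred.
rewrite (bigD1 (X n t, X n.+1 t))//= !eqxx andbT big1 ?addr0.
  by case: alive; rewrite ?mulr1 ?mulr0.
move=> [u v]; rewrite xpair_eqE /= [u == _]eq_sym [v == _]eq_sym.
by move=> /negPf->; rewrite andbF mulr0.
Qed.

Lemma measurable_alive_cost (n : nat) : measurable_fun [set: T]%classic
  (fun t => (if alive n t then c (X n t) (X n.+1 t) else 0)%:E).
Proof.
under eq_fun do rewrite alive_cost_sum.
apply: emeasurable_sum => q; apply/measurable_EFinP.
apply: measurable_funM => //; apply: measurable_indic.
exact: measurable_alive_step.
Qed.

Lemma integral_alive_cost (n : nat) :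
  (\int[P]_t (if alive n t then c (X n t) (X n.+1 t) else 0)%:E =
   (\sum_(q : V * V) c q.1 q.2 * (killed_prob n q.1 * p q.1 q.2))%:E)%E.
Proof.
under eq_integral do rewrite alive_cost_sum.
rewrite ge0_integral_sum//; last 2 first.
- move=> q; apply/measurable_EFinP.
  apply: measurable_funM => //; apply: measurable_indic.
  exact: measurable_alive_step.
- by move=> q t _; rewrite lee_fin mulr_ge0// indicE ler0n.
rewrite -sumEFin; apply: eq_bigr => q _.
rewrite (integralZl_indic _ (fun=> [set t |
  [&& alive n t, X n t == q.1 & X n.+1 t == q.2]]%classic))//; last 2 first.
- by rewrite ltNge c_ge0.
- exact: measurable_alive_step.
rewrite integral_indic//; last exact: measurable_alive_step.
rewrite classical_sets.setIT EFinM; congr (_ * _)%E; exact: killed_prob_step.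
Qed.

End Chain.

(** * The truncated Green function as a potential *)

Section Walk.
Variables (R : realType) (V : finType) (e : rel V) (w : V -> V -> R) (x y : V).
Variables (d : measure_display) (T : measurableType d) (P : probability T R).
Variable X : nat -> T -> V.
Hypothesis w_weight : edge_weight e w.
Hypothesis X_walk : markov_chain (transition w) x P X.

Let q n u := killed_prob R V d T P X y n u.

(* The Green function of the walk killed at [y], truncated at time [N] and
   divided by the total weight; it is [0] at an isolated vertex. *)
Definition green (N : nat) (u : V) : R :=
  \sum_(n < N) q n u / \sum_z w u z.

Lemma green_ge0 (N : nat) (u : V) : 0 <= green N u.
Proof.
apply: sumr_ge0 => n _; rewrite divr_ge0 ?killed_prob_ge0//.
by apply: sumr_ge0 => z _; exact: weight_ge0 w_weight _ _.
Qed.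

Lemma green_target (N : nat) : green N y = 0.
Proof. by apply: big1 => n _; rewrite /q killed_prob_target mul0r. Qed.

(** By symmetry of [w], the inflow from the neighbors sums [q n.+1 v], while the outflow sums at
    most [q n v]; the difference telescopes to [q 0 v - q N v]. *)
Lemma green_divergence (N : nat) (v : V) : v != y ->
  \sum_u w v u * (green N v - green N u) <= q 0 v.
Proof.
move=> vy; have [wsym _ _] := w_weight.
apply: (@le_trans _ _ (\sum_(n < N) (q n v - q n.+1 v))); last first.
  have -> : \sum_(n < N) (q n v - q n.+1 v) = q 0 v - q N v.
    rewrite -(big_mkord xpredT (fun n => q n v - q n.+1 v)).
    rewrite -[RHS]opprB -(telescope_sumr (fun n => q n v) (leq0n N)) -sumrN.
    by apply: eq_bigr => n _; rewrite opprB.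
  by rewrite lerBlDr lerDl killed_prob_ge0.
under eq_bigr do rewrite mulrBr.
rewrite sumrB -mulr_suml mulr_sumr.
have -> : \sum_u w v u * green N u = \sum_(n < N) q n.+1 v.
  under eq_bigr do rewrite mulr_sumr.
  rewrite exchange_big /=; apply: eq_bigr => n _.
  rewrite /q (killed_probS _ _ _ _ _ _ _ _ X_walk)//; apply: eq_bigr => u _.
  by rewrite /transition mulrCA [w v u]wsym.
rewrite sumrB lerD2r; apply: ler_sum => n _.
(* At an isolated vertex the total weight is [0], and the claim reduces to [0 <= q n v]. *)
have [->|W0] := eqVneq (\sum_z w v z) 0; first by rewrite mul0r killed_prob_ge0.
by rewrite mulrCA divff// mulr1.
Qed.

End Walk.


(** * The expected cost as a sum over edges *)

Lemma step_cost_sum (R : realType) (V : finType) (e : rel V) (f : edge e -> R)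
    (u v : V) :
  step_cost f u v = \sum_(E : edge e | [set u; v]%SET == val E) f E.
Proof.
rewrite /step_cost; case: insubP => [E _ <-|uvE].
  by under eq_bigl do rewrite eq_sym (inj_eq val_inj); rewrite big_pred1_eq.
(* Off the edges the sum is empty, in agreement with the default value [0]. *)
by rewrite big1// => E /eqP uv; move: uvE; rewrite uv (valP E).
Qed.

Theorem theorem3 (R : realType) (V : finType) (e : rel V)
    (e_simple : simple_graph e) (e_connected : connected_graph e)
    (V_ge2 : (2 <= #|V|)%N)
    (w : V -> V -> R) (w_weight : edge_weight e w)
    (f : edge e -> R) (f_ge0 : forall E : edge e, 0 <= f E)
    (x y : V)
    (d : measure_display) (T : measurableType d) (P : probability T R)
    (X : nat -> T -> V)
    (X_walk : markov_chain (transition w) x P X) :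
  (expected_cost f y P X <=
   (\sum_(E : edge e)
      (1 + 2 * \sum_(1 <= i < (edge_dist y E).+1) asymmetry e w ^+ i)
      * f E)%:E)%E.
Proof.
have c_ge0 u v : 0 <= step_cost f u v by rewrite step_cost_sum sumr_ge0.
rewrite /expected_cost /cost_until integral_nneseries//; last 2 first.
- by move=> n; exact: measurable_alive_cost X_walk _ _ _.
- by move=> n t _; case: ifP => _; rewrite lee_fin.
have int_ge0 n : (0 <= \int[P]_t (if [forall k : 'I_n.+1, X k t != y]
    then step_cost f (X n t) (X n.+1 t) else 0)%:E)%E.
  by apply: integral_ge0 => t _; case: ifP => _; rewrite lee_fin.
(* It suffices to bound every partial sum, by a quantity independent of [N]. *)
apply: lime_le; first exact: is_cvg_nneseries.
apply: nearW => N.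
under eq_bigr do rewrite (integral_alive_cost _ _ _ _ _ _ _ _ X_walk _ _ c_ge0).
rewrite sumEFin lee_fin big_mkord exchange_big /=.
set g := green R V w y d T P X N.
(* The denominator of [transition] is absorbed into [g], leaving the weight [w q.1 q.2] that
   [edge_flow_le] expects. *)
have -> : \sum_(q : V * V) \sum_(n < N) step_cost f q.1 q.2 *
      (killed_prob R V d T P X y n q.1 * transition w q.1 q.2) =
    \sum_(q : V * V) \sum_(E : edge e | [set q.1; q.2]%SET == val E)
      w q.1 q.2 * g q.1 * f E.
  apply: eq_bigr => q _; rewrite -mulr_sumr -step_cost_sum -mulr_sumr mulrC.
  congr (_ * _); rewrite mulr_sumr; apply: eq_bigr => n _.
  by rewrite /transition mulrCA.
(* Grouped by edge, the orientations of [E] form the left side of [edge_flow_le], with the killed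
   law at time [0] as source. *)
rewrite (exchange_big_dep predT)//=; apply: ler_sum => E _.
rewrite -mulr_suml ler_wpM2r//.
apply: (edge_flow_le R V e w w_weight y g (killed_prob R V d T P X y 0)) => //.
- exact: green_ge0 w_weight _.
- exact: green_target.
- exact: killed_prob_ge0.
- exact: sum_killed_prob0_le1 X_walk _.
- exact: green_divergence w_weight X_walk _.
Qed.
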